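(* Let $1\le k\le n$ and let $X_1,\ldots,X_n,Z$ be random variables with an arbitrary joint discrete distribution, taking only non-negative integers as values. Let $F_i(x)=P(X_i\le x)$, $\bar F_i(x)=P(X_i>x)$, $p_i(x)=P(X_i=x)$, $F_i(x^-)=P(X_i<x)$, $\bar G(x)=P(Z>x)$, and $T=\min(X_{n-k+1:n}+Z,\,X_{n-k+2:n})$. Let $t$ be a non-negative integer with $P(X_{1:n}>t)>0$, let $(X_1^{(t)},\ldots,X_n^{(t)},Z^{(t)})$ be a random vector whose distribution is the conditional distribution of $(X_1-t,\ldots,X_n-t,Z)$ given $X_{1:n}>t$, and let $T^{(t)}=\min(X^{(t)}_{n-k+1:n}+Z^{(t)},X^{(t)}_{n-k+2:n})$. Then for $s=0,1,\ldots$ $$P(T-t>s\mid X_{1:n}>t)=P(T^{(t)}>s)=\sum_{v=0}^{n-k}\Bigg\{\sum_{(j_1,\ldots,j_n)\in\mathcal P_{v,n-k+1}}\sum_{u=1}^{s}P\big(A^{u,s}_{v}(j_1,\ldots,j_n)\big)+\sum_{(j_1,\ldots,j_n)\in\mathcal P_v}P\big(C^{s}_{v}(j_1,\ldots,j_n)\big)\Bigg\}.$$ Furthermore: (i) if $X_1,\ldots,X_n,Z$ are independent, this equals $$\Big(\prod_{\ell=1}^{n}\bar F_\ell(t)\Big)^{-1}\sum_{v=0}^{n-k}\Bigg\{\sum_{(j_1,\ldots,j_n)\in\mathcal P_{v,n-k+1}}\sum_{u=t+1}^{s+t}\Big(\prod_{\ell=1}^{v}(F_{j_\ell}(u^-)-F_{j_\ell}(t))\Big)\Big(\prod_{\ell=v+1}^{n-k+1}p_{j_\ell}(u)\Big)\Big(\prod_{\ell=n-k+2}^{n}\bar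 F_{j_\ell}(s+t)\Big)\bar G(s+t-u)$$ $$+\sum_{(j_1,\ldots,j_n)\in\mathcal P_v}\Big(\prod_{\ell=1}^{v}(F_{j_\ell}(s+t)-F_{j_\ell}(t))\Big)\Big(\prod_{\ell=v+1}^{n}\bar F_{j_\ell}(s+t)\Big)\Bigg\};$$ (ii) if $(X_1,\ldots,X_n,Z)$ is exchangeable, this equals $$n!\sum_{v=0}^{n-k}\frac1{v!}\Bigg\{\frac1{(n-k+1-v)!\,(k-1)!}\sum_{u=1}^{s}P\big(A^{u,s}_{v}(1,\ldots,n)\big)+\frac1{(n-v)!}P\big(C^{s}_{v}(1,\ldots,n)\big)\Bigg\};$$ (iii) if $(X_1,\ldots,X_n)$ and $Z$ are independent and $X_1,\ldots,X_n$ are independent and identically distributed with $F(x)=P(X_i\le x)$, $\bar F(x)=P(X_i>x)$, $F(x^-)=P(X_i<x)$, $p(x)=P(X_i=x)$, this equals $$\frac{n!}{(\bar F(t))^n}\sum_{v=0}^{n-k}\frac1{v!}\Bigg\{\frac{(\bar F(t+s))^{k-1}}{(n-k+1-v)!\,(k-1)!}\sum_{u=t+1}^{s+t}(F(u^-)-F(t))^{v}(p(u))^{n-k+1-v}\,\bar G(t+s-u)+\frac1{(n-v)!}(F(s+t)-F(t))^{v}(\bar F(s+t))^{n-v}\Bigg\}.$$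
   Context: For random variables $W_1,\ldots,W_n$, $W_{1:n}\le\cdots\le W_{n:n}$ are the order statistics and $W_{n+1:n}:=\infty$. $T$ is the lifetime of a $k$-out-of-$n$ system with active component lifetimes $X_1,\ldots,X_n$ and one cold standby unit with lifetime $Z$. For $0\le r\le n$, $\mathcal P_r$ is the set of permutations $(j_1,\ldots,j_n)$ of $(1,\ldots,n)$ with $j_1<\cdots<j_r$ and $j_{r+1}<\cdots<j_n$. For $0\le r<q\le n$, $\mathcal P_{r,q}$ is the set of permutations with $j_1<\cdots<j_r$, $j_{r+1}<\cdots<j_q$ and $j_{q+1}<\cdots<j_n$. The events (formed from the variables $X_i^{(t)}$, $Z^{(t)}$) are $$A^{u,s}_{v}(j_1,\ldots,j_n)=\bigcap_{\ell=1}^{v}\{X^{(t)}_{j_\ell}<u\}\cap\bigcap_{\ell=v+1}^{n-k+1}\{X^{(t)}_{j_\ell}=u\}\cap\bigcap_{\ell=n-k+2}^{n}\{X^{(t)}_{j_\ell}>s\}\cap\{Z^{(t)}>s-u\},$$ $$C^{s}_{v}(j_1,\ldots,j_n)=\bigcap_{\ell=1}^{v}\{X^{(t)}_{j_\ell}\le s\}\cap\bigcap_{\ell=v+1}^{n}\{X^{(t)}_{j_\ell}>s\}.$$ Conventions: empty sums are $0$, empty products are $1$ (so $0^0=1$), and empty intersections are the whole sample space. A random vector is exchangeable if every permutation of it has the same distribution. *)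

(* Defs.v *)
From HB Require Import structures.
From mathcomp Require Import all_boot all_order all_algebra all_fingroup.
From mathcomp Require Import all_classical all_reals all_analysis.

Set Implicit Arguments.
Unset Strict Implicit.
Unset Printing Implicit Defensive.

Import Order.TTheory GRing.Theory Num.Theory.
Import numFieldNormedType.Exports.

Local Open Scope classical_set_scope.
Local Open Scope ring_scope.

(* The i-th order statistic, i >= 1; the default value of [nth] implements the
   convention that the (n+1)-st order statistic of n values is +oo. *)
Definition order_stat (R : realType) (n : nat) (x : 'I_n -> R) (i : nat) :
    \bar R :=
  nth +oo%E [seq y%:E | y <- sort <=%R (codom x)] i.-1.

Definition lifetime (R : realType) (n k : nat) (x : 'I_n -> R) (z : R) :
    \bar R :=
  Order.min (order_stat x (n - k + 1) + z%:E)%E (order_stat x (n - k + 2)).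

Definition prob (d : measure_display) (Om : measurableType d) (R : realType)
    (P : probability Om R) (A : set Om) : R :=
  fine (P A).

(* Meaningful when [prob P B != 0]. *)
Definition cond_prob (d : measure_display) (Om : measurableType d)
    (R : realType) (P : probability Om R) (A B : set Om) : R :=
  prob P (A `&` B) / prob P B.

Definition random_vector (Om : Type) (R : realType) (m : nat)
    (W : 'I_m -> Om -> R) (w : Om) : m.-tuple R :=
  [tuple W i w | i < m].

Definition add_last (A : Type) (n : nat) (x : 'I_n -> A) (z : A) :
    'I_n.+1 -> A :=
  fun i => if unlift ord_max i is Some j then x j else z.

Definition mutually_independent (d : measure_display) (Om : measurableType d)
    (R : realType) (P : probability Om R) (m : nat) (W : 'I_m -> Om -> R) :
    Prop :=
  forall (J : {set 'I_m}) (B : 'I_m -> set R),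
    (forall i, measurable (B i)) ->
    prob P (\bigcap_(i in [set` J]) (W i @^-1` B i)) =
    \prod_(i in J) prob P (W i @^-1` B i).

Definition vector_independent (d : measure_display) (Om : measurableType d)
    (R : realType) (P : probability Om R) (n : nat) (X : 'I_n -> Om -> R)
    (Z : Om -> R) : Prop :=
  forall (B : set (n.-tuple R)) (C : set R), measurable B -> measurable C ->
    prob P ((random_vector X @^-1` B) `&` (Z @^-1` C)) =
    prob P (random_vector X @^-1` B) * prob P (Z @^-1` C).

Definition identically_distributed (d : measure_display)
    (Om : measurableType d) (R : realType) (P : probability Om R) (n : nat)
    (X : 'I_n -> Om -> R) : Prop :=
  forall (i i' : 'I_n) (B : set R), measurable B ->
    prob P (X i @^-1` B) = prob P (X i' @^-1` B).

Definition exchangeable (d : measure_display) (Om : measurableType d)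
    (R : realType) (P : probability Om R) (m : nat) (W : 'I_m -> Om -> R) :
    Prop :=
  forall (sigma : 'S_m) (B : set (m.-tuple R)), measurable B ->
    prob P (random_vector (fun i => W (sigma i)) @^-1` B) =
    prob P (random_vector W @^-1` B).

(* Ordinals count from 0: the paper's j_l is the value of [j] at the ordinal
   l - 1, so [increasing_on j a b] says j_(a+1) < ... < j_b. *)
Definition increasing_on (n : nat) (j : 'S_n) (a b : nat) : bool :=
  [forall l : 'I_n, forall m : 'I_n,
     [&& a <= l, l < m & m < b]%N ==> (j l < j m)%N].

Definition perms (n r : nat) : {set 'S_n} :=
  [set j : 'S_n | increasing_on j 0 r && increasing_on j r n]%SET.

Definition perms2 (n r q : nat) : {set 'S_n} :=
  [set j : 'S_n | [&& increasing_on j 0 r, increasing_on j r q &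
                      increasing_on j q n]]%SET.

Definition evA (Om : Type) (R : realType) (n k : nat) (X : 'I_n -> Om -> R)
    (Z : Om -> R) (u s v : nat) (j : 'S_n) : set Om :=
  \bigcap_(l in [set l : 'I_n | (l < v)%N]) [set w | X (j l) w < u%:R] `&`
  \bigcap_(l in [set l : 'I_n | (v <= l < n - k + 1)%N])
    [set w | X (j l) w = u%:R] `&`
  \bigcap_(l in [set l : 'I_n | (n - k + 1 <= l)%N])
    [set w | X (j l) w > s%:R] `&`
  [set w | Z w > s%:R - u%:R].

Definition evC (Om : Type) (R : realType) (n : nat) (X : 'I_n -> Om -> R)
    (s v : nat) (j : 'S_n) : set Om :=
  \bigcap_(l in [set l : 'I_n | (l < v)%N]) [set w | X (j l) w <= s%:R] `&`
  \bigcap_(l in [set l : 'I_n | (v <= l)%N]) [set w | X (j l) w > s%:R].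

(* Main.v *)
(* On the event that all components are alive at t, the residual lifetimes are
   positive integers.  The residual lifetime exceeds s iff either fewer than
   n-k+1 components fail by time s (the events C), or exactly n-k+1 do and the
   standby unit, started at the (n-k+1)-st failure time u, outlives s - u (the
   events A).  An ordered set partition is listed by exactly one permutation that
   increases on each block, so pointwise the indicator of {T > s} is the sum of
   the indicators of the A and C; taking conditional expectations gives the
   formula.  Independence factors each term, exchangeability makes the terms with
   the same v equal, and counting the permutations gives (ii) and (iii). *)
Require Import Defs.
From HB Require Import structures.
From mathcomp Require Import all_boot all_order all_algebra all_fingroup.
From mathcomp Require Import all_classical all_reals all_analysis.
From mathcomp Require Import zify ring lra.

Set Implicit Arguments.
Unset Strict Implicit.
Unset Printing Implicit Defensive.

Import Order.TTheory GRing.Theory Num.Theory.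
Import numFieldNormedType.Exports.

(** * Block-increasing permutations *)

Section Combinatorics.
Local Open Scope nat_scope.

(** Index 0, 1 or 2 of the block of positions containing [l] when [v <= q], obtained by counting the
    cut points already passed. *)
Definition block (v q l : nat) : nat := (v <= l) + (q <= l).

(** Merges the three monotonicity conditions into one condition on pairs of positions in the same
    block, which is the form that the sorting argument uses. *)
Lemma mem_perms2 n v q (j : 'S_n) : v <= q -> q <= n ->
  (j \in perms2 n v q) =
  [forall l : 'I_n, forall m : 'I_n,
     (l < m) && (block v q l == block v q m) ==> (j l < j m)].
Proof.
move=> vq qn; rewrite inE; apply/and3P/'forall_forallP => [[h1 h2 h3] l m|h].
  apply/implyP => /andP[lm /eqP e]; move: e; rewrite /block => e.
  have mn := ltn_ord m.
  have h a b (H : increasing_on j a b) : a <= l -> m < b -> j l < j m.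
    move=> al mb; move/forallP/(_ l)/forallP/(_ m)/implyP: H; apply.
    by rewrite al lm.
  case: (ltnP m v) => mv; first exact: h h1 _ _.
  case: (ltnP m q) => mq; first by apply: (h _ _ h2) => //; lia.
  by apply: (h _ _ h3) => //; lia.
by split; apply/'forall_forallP => l m; apply/implyP => /and3P[al lm mb];
  have /implyP := h l m; apply; rewrite lm /block /=; have := ltn_ord m; lia.
Qed.

Lemma count_codom (I : finType) (T : Type) (f : I -> T) (a : pred T) :
  count a (codom f) = #|[pred i | a (f i)]|.
Proof.
rewrite count_map -size_filter cardE; congr size.
by rewrite {1}/enum_mem -filter_predI; apply: eq_filter => i; rewrite !inE andbT.
Qed.

Lemma card_ord_range n a b : a <= b -> b <= n ->
  #|[pred l : 'I_n | a <= l < b]| = b - a.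
Proof.
move=> ab bn; rewrite -sum1_card (eq_bigl (fun l : 'I_n => (true && (l < b)) && (a <= l))).
  rewrite -(big_geq_mkord a n (fun i => true && (i < b)) (fun=> 1)) -big_nat_widen //.
  by rewrite sum_nat_const_nat muln1.
by move=> l; rewrite inE andbC.
Qed.

(** * Permutations matching a labelling of the components *)

Section Fiber.
Variables (n v q : nat) (f : 'I_n -> nat).
Hypotheses (vq : v <= q) (qn : q <= n).

(** Order by label, ties broken by index. A block-increasing permutation whose labels match the
    blocks lists the components in exactly this order. *)
Let lex (i i' : 'I_n) := (f i < f i') || (f i == f i') && (i < i').
Let lexeq (i i' : 'I_n) := (f i < f i') || (f i == f i') && (i <= i').

Let lex_trans : transitive lex.
Proof. by move=> x y z; rewrite /lex; lia. Qed.

Let lex_irr : irreflexive lex.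
Proof. by move=> x; rewrite /lex; lia. Qed.

Let ord_sorted : sorted (fun i i' : 'I_n => i < i') (enum 'I_n).
Proof. by have := iota_ltn_sorted 0 n; rewrite -val_enum_ord sorted_map. Qed.

Let adapted (j : 'S_n) := [forall l : 'I_n, f (j l) == block v q l].

(** Both permutations list all ordinals in strictly increasing [lex] order, and such a list is
    unique. *)
Lemma adapted_inj (j j' : 'S_n) :
  j \in perms2 n v q -> j' \in perms2 n v q -> adapted j -> adapted j' -> j = j'.
Proof.
have lexj i : i \in perms2 n v q -> adapted i -> sorted lex [seq i l | l <- enum 'I_n].
  rewrite mem_perms2 // => /'forall_forallP ip /forallP ia.
  apply: homo_sorted ord_sorted => l m lm; rewrite /lex (eqP (ia l)) (eqP (ia m)).
  have /implyP := ip l m; rewrite lm /=; case: eqP => [_ -> //|e _].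
    by rewrite orbT.
  by move: e; rewrite /block; lia.
move=> jp jp' ja ja'; apply/permP => l.
suff /eq_in_map/(_ l) : [seq j l | l <- enum 'I_n] = [seq j' l | l <- enum 'I_n].
  by apply; rewrite mem_enum.
apply: (irr_sorted_eq lex_trans lex_irr); [exact: lexj|exact: lexj|].
move=> x; have im (i : 'S_n) : x \in [seq i l | l <- enum 'I_n].
  by rewrite -(permKV i x) map_f ?mem_enum.
by rewrite !im.
Qed.

(** The permutation is read off the ordinals sorted by label and then by index. The block indices
    are already sorted, so having the same multiset of values forces the sorted labels to coincide
    with them. *)
Lemma adapted_ex : perm_eq (codom f) (codom (fun l : 'I_n => block v q l)) ->
  exists2 j : 'S_n, j \in perms2 n v q & adapted j.
Proof.
move=> fperm; set s := sort lexeq (enum 'I_n).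
have size_s : size s = n by rewrite size_sort size_enum_ord.
have s_uniq : uniq s by rewrite sort_uniq enum_uniq.
have s_sorted : sorted lexeq s.
  by apply: sort_sorted => x y; rewrite /lexeq; lia.
have j_inj : injective (fun l : 'I_n => nth l s l).
  move=> l m /=; rewrite (set_nth_default l) ?size_s // => /eqP.
  by rewrite nth_uniq ?size_s // => /eqP/val_inj.
have fs : [seq f i | i <- s] = [seq block v q l | l : 'I_n].
  apply: (sorted_eq leq_trans anti_leq).
  - by apply: homo_sorted s_sorted => x y; rewrite /lexeq; lia.
  - by apply: homo_sorted ord_sorted => x y; rewrite /block; lia.
  - apply: perm_trans fperm; rewrite /codom /image_mem.
    by apply: perm_map; rewrite perm_sort enumT.
have fj l : f (nth l s l) = block v q l.
  rewrite -(nth_map l 0 f) ?size_s // fs (nth_map l) ?size_enum_ord //.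
  by rewrite nth_ord_enum.
exists (perm j_inj).
  rewrite mem_perms2 //; apply/'forall_forallP => l m.
  apply/implyP => /andP[lm /eqP e]; rewrite !permE.
  (* Positions of one block carry equal labels, so [lexeq] between their images reduces to [<=] of
     the indices; injectivity makes it strict. *)
  have ltr : transitive lexeq by move=> x y z; rewrite /lexeq; lia.
  have := sorted_ltn_nth ltr l s_sorted; move=> /(_ l m).
  rewrite !inE size_s !ltn_ord => /(_ isT isT lm).
  rewrite (@set_nth_default _ s m l m) ?size_s // /lexeq !fj e ltnn eqxx /= => le.
  rewrite ltn_neqAle le andbT; apply/eqP => /val_inj/j_inj lm'.
  by rewrite lm' ltnn in lm.
by apply/forallP => l; rewrite permE fj.
Qed.

(** The count is 0 or 1. An adapted permutation carries the multiset of block indices onto that of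
    the labels, so none exists when these differ. *)
Lemma card_adapted : #|[pred j in perms2 n v q | adapted j]| =
  perm_eq (codom f) (codom (fun l : 'I_n => block v q l)).
Proof.
case: (boolP (perm_eq _ _)) => [/adapted_ex[j jp ja]|nperm].
  rewrite (eq_card (B := pred1 j)) ?card1 // => i.
  by apply/idP/eqP => [/andP[ip ia]|->]; [exact: adapted_inj|apply/andP].
apply: eq_card0 => j; apply/negP => /andP[_ /forallP ja].
case/negP: nperm; apply/seq.permP => a; rewrite !count_map.
transitivity (count (preim f a) [seq j l | l <- enum 'I_n]).
  apply: (seq.permP _ (preim f a)); apply: uniq_perm; first by rewrite -enumT enum_uniq.
    by rewrite map_inj_uniq ?enum_uniq //; exact: perm_inj.
  by move=> x; rewrite -enumT mem_enum -(permKV j x) map_f ?mem_enum.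
by rewrite count_map -!enumT; apply: eq_count => l /=; rewrite (eqP (ja l)).
Qed.
End Fiber.

Lemma card_block n v q x : v <= q -> q <= n ->
  #|[pred l : 'I_n | block v q l == x]| =
  if x == 0 then v else if x == 1 then q - v else if x == 2 then n - q else 0.
Proof.
move=> vq qn; have vn := leq_trans vq qn.
have E a b : (forall l, l < n -> (block v q l == x) = (a <= l < b)) ->
    #|[pred l : 'I_n | block v q l == x]| = #|[pred l : 'I_n | a <= l < b]|.
  by move=> h; apply: eq_card => l; rewrite !inE h.
case: eqP => [x0|x0]; first by rewrite (E 0 v) ?card_ord_range ?subn0 // /block; lia.
case: eqP => [x1|x1]; first by rewrite (E v q) ?card_ord_range // /block; lia.
case: eqP => [x2|x2]; first by rewrite (E q n) ?card_ord_range // /block; lia.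
by rewrite (E 0 0) ?card_ord_range // /block; lia.
Qed.

Lemma card_pred_sum n (a : pred 'I_n) : #|a| = \sum_i a i.
Proof.
by rewrite -sum1_card big_mkcond; apply: eq_bigr => i _; rewrite unfold_in; case: (a i).
Qed.

(** Common pointwise shape of [evA] and [evC]: one predicate for each of three consecutive blocks of
    positions. For [evC] the third block is empty. *)
Definition fits n (v q : nat) (a b c : pred 'I_n) (j : 'S_n) :=
  [forall l : 'I_n, [&& (l < v) ==> a (j l), (v <= l < q) ==> b (j l)
                      & (q <= l) ==> c (j l)]].

(** Disjoint predicates amount to a labelling of the components, and fitting means that labels match
    blocks. So at most one permutation fits, and one does exactly when the class sizes equal the
    block sizes. *)
Lemma card_fits n v q (a b c : pred 'I_n) : v <= q -> q <= n ->
    (forall i, ~~ (a i && b i)) -> (forall i, ~~ (a i && c i)) ->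
    (forall i, ~~ (b i && c i)) ->
  \sum_(j in perms2 n v q) fits v q a b c j =
  [&& #|a| == v, #|b| == q - v & #|c| == n - q].
Proof.
move=> vq qn ab ac bc; have vn := leq_trans vq qn.
(* The label 3 is no block index, so a component satisfying none of the predicates rules out every
   permutation. *)
pose f i := if a i then 0 else if b i then 1 else if c i then 2 else 3.
have fa i : (f i == 0) = a i by rewrite /f; case: (a i); case: (b i); case: (c i).
have fb i : (f i == 1) = b i.
  by move: (ab i); rewrite /f; case: (a i); case: (b i); case: (c i).
have fc i : (f i == 2) = c i.
  move: (ac i) (bc i).
  by rewrite /f; case: (a i); case: (b i); case: (c i).
have -> : \sum_(j in perms2 n v q) fits v q a b c j =
    #|[pred j in perms2 n v q | [forall l : 'I_n, f (j l) == block v q l]]|.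
  rewrite -sum1_card [RHS](eq_bigl (fun j : 'S_n => (j \in perms2 n v q) &&
    [forall l : 'I_n, f (j l) == block v q l])) // big_mkcondr /=.
  apply: eq_bigr => j _.
  suff -> : fits v q a b c j = [forall l : 'I_n, f (j l) == block v q l].
    by case: [forall l, _].
  apply: eq_forallb => l; rewrite /block.
  case: (ltnP l v) => lv /=.
    by rewrite leqNgt (leq_trans lv vq) /= fa !andbT.
  by case: (ltnP l q) => lq /=; rewrite ?fb ?fc ?andbT.
rewrite card_adapted //; congr nat_of_bool.
have f0 : #|[pred i | f i == 0]| = #|a| by apply: eq_card => i; rewrite !inE fa.
have f1 : #|[pred i | f i == 1]| = #|b| by apply: eq_card => i; rewrite !inE fb.
have f2 : #|[pred i | f i == 2]| = #|c| by apply: eq_card => i; rewrite !inE fc.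
apply/idP/and3P => [/seq.permP h|[/eqP ea /eqP eb /eqP ec]].
  have {}h x : #|[pred i | f i == x]| = #|[pred l : 'I_n | block v q l == x]|.
    by have := h (pred1 x); rewrite !count_codom.
  by rewrite -f0 -f1 -f2 !h !card_block //.
apply/allP => x _ /=; rewrite !count_codom.
rewrite [X in _ == X](card_block x vq qn) [X in X == _](_ : _ = #|[pred i | f i == x]|) //.
case: (x =P 0) => [->|x0]; first by rewrite f0 ea.
case: (x =P 1) => [->|x1]; first by rewrite f1 eb.
case: (x =P 2) => [->|x2]; first by rewrite f2 ec.
(* The three classes already exhaust all [n] components, so no other label occurs. *)
have : #|a| + #|b| + #|c| + #|[pred i | f i == x]| <= n.
  rewrite !card_pred_sum -!big_split /= -[leqRHS](card_ord n) -sum1_card.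
  by apply: leq_sum => i _; rewrite /= -fa -fb -fc; lia.
rewrite ea eb ec; lia.
Qed.

(** With [q = n] the third block is empty and its condition vacuous, so the two-block case is an
    instance of the three-block one. *)
Lemma perms_perms2 n v : perms n v = perms2 n v n.
Proof.
apply/setP => j; rewrite !inE; congr andb; rewrite -[LHS]andbT; congr andb.
by apply/esym/'forall_forallP => l m; rewrite leqNgt ltn_ord.
Qed.

(** Double counting: each admissible pair of disjoint sets is realised by exactly one permutation,
    and each permutation realises exactly one pair. *)
Lemma card_perms2 n v q : v <= q -> q <= n ->
  #|perms2 n v q| = 'C(n, v) * 'C(n - v, q - v).
Proof.
move=> vq qn.
(* [j] is determined by the images [V], [U] of its first two blocks. *)
pose D (V U : {set 'I_n}) := [&& #|V| == v, U \subset ~: V & #|U| == q - v].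
have DE V U : D V U -> \sum_(j in perms2 n v q)
    fits v q (mem V) (mem U) (mem (~: (V :|: U))) j = 1.
  case/and3P => /eqP cV UV /eqP cU; rewrite card_fits //.
  - rewrite cV cU !eqxx cardsCs finset.setCK cardsU (_ : V :&: U = finset.set0).
      by rewrite cards0 cV cU card_ord subn0 subnKC // eqxx.
    by apply/eqP; rewrite finset.setI_eq0 fintype.disjoint_sym finset.disjoints_subset.
  - move=> i; apply/andP => -[/= iV iU].
    by move/fintype.subsetP/(_ _ iU): UV; rewrite inE iV.
  - by move=> i; rewrite /= !inE; case: (i \in V).
  - by move=> i; rewrite /= !inE; case: (i \in U); rewrite ?orbT.
transitivity (\sum_(V : {set 'I_n}) \sum_(U | D V U) 1); last first.
  rewrite -[in 'C(n, v)](card_ord n) -card_draws -sum1_card big_distrl /=.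
  rewrite [RHS]big_mkcond /=; apply: eq_bigr => V _; rewrite inE.
  case: eqP => cV; last by rewrite big_pred0 // /D; move=> U; case: eqP.
  have -> : n - v = #|~: V| by rewrite [RHS]cardsCs finset.setCK card_ord cV.
  rewrite mul1n -cards_draws -sum1_card.
  by apply: eq_bigl => U; rewrite /D inE cV eqxx.
(* Each 1 becomes the number of permutations fitting the pair. After exchanging the sums, it remains
   to see that each [j] fits a single pair. *)
under eq_bigr => V _ do under eq_bigr => U DU do rewrite -(DE V U DU).
under eq_bigr do rewrite exchange_big /=.
rewrite exchange_big /= -sum1_card; apply: eq_bigr => j jp.
pose V := [set j l | l in [pred l : 'I_n | l < v]]%SET.
pose U := [set j l | l in [pred l : 'I_n | v <= l < q]]%SET.
have jV l : (j l \in V) = (l < v) by rewrite mem_imset //; exact: perm_inj.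
have jU l : (j l \in U) = (v <= l < q) by rewrite mem_imset //; exact: perm_inj.
have fitsE V' U' : D V' U' ->
    fits v q (mem V') (mem U') (mem (~: (V' :|: U'))) j =
    (V' == V) && (U' == U) :> nat.
  case/and3P => _ /fintype.subsetP UV' _; congr nat_of_bool.
  apply/forallP/andP => [h|[/eqP-> /eqP->] l]; last first.
    by rewrite /= !inE jV jU; case: (ltnP l v) => lv; case: (ltnP l q) => lq //=;
      rewrite ?implybT //; move: (leq_trans lv vq); rewrite ltnNge lq.
  have h' l : (j l \in V') = (l < v) /\ (j l \in U') = (v <= l < q).
    move: (h l) (UV' (j l)); rewrite /= !inE.
    have : l < v -> l < q by move=> lv; exact: leq_trans vq.
    case: (ltnP l v) => lv; case: (ltnP l q) => lq //=;
      case: (j l \in V'); case: (j l \in U') => //=; try (by split); move=> H1 H2 H3;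
      (by have := H1 isT) || (by have := H3 isT).
  by split; apply/eqP/setP => x; rewrite -(permKV j x) ?jV ?jU; case: (h' (j^-1 x)%g).
under eq_bigr => V' _ do under eq_bigr => U' DU' do rewrite (fitsE _ _ DU').
rewrite (bigD1 V) //= (bigD1 U) /=; last first.
  rewrite /D !card_imset; [|exact: perm_inj..].
  have -> : #|[pred l : 'I_n | l < v]| = v.
    by rewrite (card_ord_range (a := 0)) ?subn0 ?(leq_trans vq).
  rewrite card_ord_range // !eqxx andbT; apply/fintype.subsetP => x.
  by rewrite -(permKV j x) finset.in_setC jV jU -leqNgt => /andP[].
rewrite !eqxx big1 => [|U' /andP[_ /negPf->]] //; rewrite big1 // => V' /negPf nV.
by rewrite big1 // => U' _; rewrite nV.
Qed.

Lemma sum_eq_andb (m x : nat) (b : nat -> bool) :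
  \sum_(0 <= v < m) ((x == v) && b v) = (x < m) && b x.
Proof.
elim: m => [|m IH]; first by rewrite big_nil.
rewrite big_nat_recr //= IH (ltnS x) [x <= m]leq_eqVlt.
by case: (x =P m) => [->|_] /=; rewrite ?ltnn ?addn0.
Qed.

(** * Survival of an integer-valued system as a sum over failure patterns *)

Section Counting.
Variables (n s m z : nat) (y : 'I_n -> nat).
Hypotheses (y_gt0 : forall i, 0 < y i) (m_gt0 : 0 < m) (mn : m <= n).

Let N c := #|[pred i | y i <= c]|.

Let N_mono c c' : c <= c' -> N c <= N c'.
Proof.
move=> cc'; apply: subset_leq_card; apply/fintype.subsetP => i; rewrite !inE => /leq_trans.
exact.
Qed.

Let N_lt u : #|[pred i | y i < u.+1]| = N u.
Proof. by apply: eq_card => i; rewrite !inE ltnS. Qed.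

Let N_eq u : #|[pred i | y i < u]| + #|[pred i | y i == u]| = N u.
Proof.
rewrite /N !card_pred_sum -big_split /=; apply: eq_bigr => i _.
by rewrite /=; case: ltngtP.
Qed.

Let N_gt : N s + #|[pred i | s < y i]| = n.
Proof.
rewrite /N !card_pred_sum -big_split -[RHS](card_ord n) -sum1_card /=.
by apply: eq_bigr => i _; case: ltnP.
Qed.

(* [u0] is the m-th order statistic. *)
Let jump : N s = m -> exists u0, [/\ 0 < u0 <= s, N u0 = m, #|[pred i | y i < u0]| < m
  & forall u, N u = m -> #|[pred i | y i < u]| < m -> u = u0].
Proof.
move=> Ns; have ex : exists u, m <= N u by exists s; rewrite Ns.
have N0 : N 0 = 0 by apply: eq_card0 => i; rewrite inE leqn0; case: (y i) (y_gt0 i).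
(* The least time with at least [m] failures. It is positive since nothing has failed at time 0;
   minimality leaves fewer than [m] failures strictly before it, and a later [u] would have at least
   [m] before it. *)
case: (ex_minnP ex) => u0 mu0 min0; exists u0.
have u0s : u0 <= s by apply: min0; rewrite Ns.
have u0gt : 0 < u0 by case: (u0) mu0 => // ; rewrite N0 leqNgt m_gt0.
split.
- by rewrite u0gt.
- by apply/eqP; rewrite eqn_leq mu0 -Ns N_mono.
- rewrite -(prednK u0gt) N_lt ltnNge; apply/negP => /min0.
  by rewrite leqNgt prednK // leqnn.
- move=> u Nu lu; apply/eqP; rewrite eqn_leq min0 ?Nu // andbT leqNgt.
  apply/negP => uu; move: lu; rewrite -(prednK (leq_ltn_trans (leq0n u0) uu)).
  rewrite N_lt ltnNge (leq_trans mu0) // N_mono //; lia.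
Qed.

(** With [m] the number of failures that calls on the standby unit, the left side says that the
    system survives [s]. If [N s < m], only the last summand contributes; if [N s > m], both sides
    vanish; if [N s = m], only the time [u0] of the m-th failure contributes, and the condition
    becomes [s < u0 + z]. *)
Lemma lifetime_count :
  ((#|[pred i | y i + z <= s]| < m) && (N s <= m) : nat) =
  \sum_(0 <= v < m)
    (\sum_(1 <= u < s.+1)
       ([&& #|[pred i | y i < u]| == v, #|[pred i | y i == u]| == m - v
          & #|[pred i | s < y i]| == n - m] && (s < u + z)) + (N s == v)).
Proof.
have Nz : #|[pred i | y i + z <= s]| <= N s.
  apply: subset_leq_card; apply/fintype.subsetP => i; rewrite !inE; lia.
have Ngt := N_gt.
rewrite big_split /= exchange_big /=.
have -> : \sum_(0 <= v < m) (N s == v) = (N s < m).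
  by under eq_bigr do rewrite -[_ == _]andbT; rewrite sum_eq_andb andbT.
(* Summing over [v] forgets how many of the [m] failures come strictly before [u]; what remains is
   that the m-th failure occurs at [u] and no further one by [s]. *)
have -> : \sum_(1 <= u < s.+1) \sum_(0 <= v < m)
      ([&& #|[pred i | y i < u]| == v, #|[pred i | y i == u]| == m - v
          & #|[pred i | s < y i]| == n - m] && (s < u + z)) =
    \sum_(1 <= u < s.+1) [&& #|[pred i | y i < u]| < m, N u == m, N s == m & s < u + z].
  apply: eq_bigr => u _.
  under eq_bigr do rewrite -andbA.
  rewrite sum_eq_andb; have := N_eq u; lia.
case: (ltngtP (N s) m) => [lt|gt|Ns].
- rewrite (leq_ltn_trans Nz lt) /= big1 ?add0n // => u _.
  by rewrite !andbF.
- by rewrite andbF big1 // => u _; rewrite !andbF.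
have [u0 [/andP[u0gt u0s] Nu0 lt0 uniq0]] := jump Ns.
rewrite (bigD1_seq u0) ?mem_index_iota ?iota_uniq ?u0gt //=.
rewrite lt0 Nu0 eqxx andbT /= big1 ?addn0 => [|u uu0].
  (* If [s < u0 + z], then [y i + z <= s] forces [y i < u0], which holds for fewer than [m]
     components. Otherwise all [m] components failed by [u0] satisfy [y i + z <= s]. *)
  congr nat_of_bool; case: (ltnP s (u0 + z)) => h.
    apply: leq_ltn_trans lt0; apply: subset_leq_card.
    apply/fintype.subsetP => i; rewrite !inE; lia.
  apply/negbTE; rewrite -leqNgt -Nu0; apply: subset_leq_card.
  apply/fintype.subsetP => i; rewrite !inE; lia.
apply/eqP; rewrite eqb0; apply/negP => /andP[l1 /andP[/eqP l2 _]].
by rewrite (uniq0 u) ?eqxx in uu0.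
Qed.

(** By [card_fits], each condition on class sizes in [lifetime_count] is a sum over block-increasing
    permutations. *)
Lemma lifetime_fits :
  ((#|[pred i | y i + z <= s]| < m) && (N s <= m) : nat) =
  \sum_(0 <= v < m)
    (\sum_(j in perms2 n v m) \sum_(1 <= u < s.+1)
       (fits v m (fun i => y i < u) (fun i => y i == u) (fun i => s < y i) j &&
          (s < u + z)) +
     \sum_(j in perms n v) fits v n (fun i => y i <= s) (fun i => s < y i) pred0 j).
Proof.
rewrite lifetime_count; apply: eq_big_nat => v /andP[_ vm]; congr addn.
  rewrite exchange_big /=; apply: eq_big_nat => u /andP[_ us].
  under [RHS]eq_bigr do rewrite -mulnb.
  rewrite -big_distrl /= card_fits ?(ltnW vm) ?mulnb // => i /=; lia.
rewrite perms_perms2 card_fits ?(ltnW (leq_trans vm mn)) //.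
- rewrite card0 subnn eqxx andbT; have Ngt := N_gt.
  have e1 : #|(fun i => y i <= s)| = N s by apply: eq_card.
  have e2 : #|(fun i => s < y i)| = #|[pred i | s < y i]| by apply: eq_card.
  by rewrite e1 e2; have := leq_trans vm mn; lia.
- by move=> i /=; lia.
- by move=> i; rewrite andbF.
- by move=> i; rewrite andbF.
Qed.
End Counting.

End Combinatorics.

Local Open Scope classical_set_scope.
Local Open Scope ring_scope.

(** * Order statistics and measurability of the events *)

Section OrderStat.
Variables (R : realType) (n : nat).
Implicit Types (x : 'I_n -> R) (c z : R).

(** In a sorted list, the entry at zero-based position [i] exceeds [c] iff at most [i] entries do
    not. Past the end the default [+oo] makes both sides true. *)
Lemma order_stat_gt x i c :
  (c%:E < order_stat x i.+1)%E = (#|[pred l | (x l <= c)%R]| <= i)%N.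
Proof.
rewrite /order_stat /=; set s := sort _ _.
have -> : #|[pred l | x l <= c]| = count (<= c) s.
  by rewrite (seq.permP (permEl (perm_sort <=%R _))) count_codom.
have s_sorted : sorted <=%R s by apply: sort_sorted; exact: le_total.
case: (ltnP i (size s)) => is_; last first.
  by rewrite nth_default ?size_map // ltry (leq_trans (count_size _ _)).
rewrite (nth_map 0) // lte_fin.
case: (leqP (count _ s) i) => h; first by apply: nth_count_gt => //; rewrite h.
by apply/negbTE; rewrite -leNgt; apply: nth_count_le.
Qed.

(** Subtracting [z] from [c] turns both terms of the minimum into counts; the one-based ranks
    [n - k + 1] and [n - k + 2] give the bounds [n - k] and [(n - k).+1]. *)
Lemma lifetime_gt k x z c : (c%:E < lifetime k x z)%E =
  (#|[pred l | (x l + z <= c)%R]| <= n - k)%N &&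
  (#|[pred l | (x l <= c)%R]| <= (n - k).+1)%N.
Proof.
rewrite /lifetime lt_min addn1 addn2 -lteBlDr // -EFinB !order_stat_gt.
by congr (_ && _); congr (_ <= _)%N; apply: eq_card => l; rewrite !inE lerBrDr.
Qed.

(** The shift by [t] acts on the active components only, since the cold standby unit does not age.
    Comparing with [c] reduces the claim to equality of counts. *)
Lemma lifetimeB_gt k x z c t :
  (c%:E < lifetime k x z - t%:E)%E = (c%:E < lifetime k (fun i => (x i - t)%R) z)%E.
Proof.
rewrite lteBrDr // -EFinD !lifetime_gt.
by congr (_ && _); congr (_ <= _)%N; apply: eq_card => l;
  rewrite !inE -lerBlDr // addrAC.
Qed.
End OrderStat.

Lemma order_stat1_gt (R : realType) n (x : 'I_n -> R) c :
  (c%:E < order_stat x 1)%E <-> forall i, c < x i.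
Proof.
rewrite order_stat_gt leqn0; split=> [/eqP/card0_eq h i|h].
  by rewrite ltNge; have := h i; rewrite !inE => ->.
by apply/eqP/eq_card0 => i; rewrite !inE leNgt h.
Qed.

(** The event is a finite union, over the index sets [S] of admissible size, of the events that
    exactly the indices in [S] satisfy [E]. *)
Lemma measurable_card (d : measure_display) (Om : measurableType d) (I : finType)
    (E : I -> Om -> bool) (p : pred nat) :
  (forall i, measurable [set w | E i w]) ->
  measurable [set w | p #|[pred i | E i w]|].
Proof.
move=> mE; have -> : [set w | p #|[pred i | E i w]|] =
    \bigcup_(S in [set S : {set I} | p #|S|])
      \bigcap_i [set w | E i w = (i \in S)].
  apply/seteqP; split=> [w /= pw|w [S /= pS SE]].
    exists [set i | E i w]%SET; rewrite /= ?cardsE // => i _ /=.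
    by rewrite finset.in_set.
  by rewrite (eq_card (B := mem S)) // => i; rewrite !inE SE.
apply: fin_bigcup_measurable => [//|S _]; apply: fin_bigcap_measurable => [//|i _].
case: (i \in S); first exact: mE.
have -> : [set w | E i w = false] = ~` [set w | E i w].
  by apply/seteqP; split=> w /= /negP; rewrite ?negbK //; case: (E i w).
exact/measurableC/mE.
Qed.

Section MeasurableEvents.
Variables (R : realType) (d : measure_display) (Om : measurableType d).

Lemma measurable_preim (f : Om -> R) (B : set R) :
  measurable_fun setT f -> measurable B -> measurable (f @^-1` B).
Proof. by move=> mf mB; rewrite -[X in measurable X]setTI; exact: mf. Qed.

Lemma measurable_le_cst (f : Om -> R) c :
  measurable_fun setT f -> measurable [set w | f w <= c].
Proof.
move=> mf; rewrite (_ : [set _ | _] = f @^-1` `]-oo, c]).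
  exact: measurable_preim.
by apply/seteqP; split=> w /=; rewrite in_itv.
Qed.

Lemma measurable_lt_cst (f : Om -> R) c :
  measurable_fun setT f -> measurable [set w | f w < c].
Proof.
move=> mf; rewrite (_ : [set _ | _] = f @^-1` `]-oo, c[).
  exact: measurable_preim.
by apply/seteqP; split=> w /=; rewrite in_itv.
Qed.

Lemma measurable_gt_cst (f : Om -> R) c :
  measurable_fun setT f -> measurable [set w | f w > c].
Proof.
move=> mf; rewrite (_ : [set _ | _] = f @^-1` `]c, +oo[).
  exact: measurable_preim.
by apply/seteqP; split=> w /=; rewrite in_itv /= andbT.
Qed.

Variables (n k : nat) (X : 'I_n -> Om -> R) (Z : Om -> R).
Hypotheses (mX : forall i, measurable_fun setT (X i)) (mZ : measurable_fun setT Z).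

Lemma measurable_alive c : measurable [set w | (c%:E < order_stat (X^~ w) 1)%E].
Proof.
rewrite (_ : [set _ | _] = \bigcap_i [set w | X i w > c]).
  by apply: fin_bigcap_measurable => // i _; exact: measurable_gt_cst.
apply/seteqP; split=> w /=; first by move/order_stat1_gt => h i _; exact: h.
by move=> h; apply/order_stat1_gt => i; exact: h.
Qed.

Lemma measurable_lifetime c : measurable [set w | (c%:E < lifetime k (X^~ w) (Z w))%E].
Proof.
rewrite (_ : [set _ | _] =
    [set w | (#|[pred l | (X l w + Z w <= c)%R]| <= n - k)%N] `&`
    [set w | (#|[pred l | (X l w <= c)%R]| <= (n - k).+1)%N]).
  apply: measurableI.
    apply: (measurable_card (fun c => (c <= n - k)%N)
      (E := fun l w => (X l w + Z w <= c)%R)) => i.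
    by apply: measurable_le_cst; exact: measurable_realfun.measurable_funD.
  apply: (measurable_card (fun c => (c <= (n - k).+1)%N)
    (E := fun l w => (X l w <= c)%R)) => i.
  exact: measurable_le_cst.
by apply/seteqP; split=> w /=; rewrite lifetime_gt => /andP.
Qed.

Lemma measurable_evA u s v j : measurable (evA k X Z u s v j).
Proof.
have mb (D : set 'I_n) (F : 'I_n -> set Om) :
    (forall i, measurable (F i)) -> measurable (\bigcap_(i in D) F i).
  by move=> mF; apply: fin_bigcap_measurable.
apply: measurableI; last exact: measurable_gt_cst.
apply: measurableI; last by apply: mb => i; exact: measurable_gt_cst.
apply: measurableI; apply: mb => i; first exact: measurable_lt_cst.
exact: (measurable_preim (B := [set u%:R])).
Qed.

Lemma measurable_evC s v j : measurable (evC X s v j).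
Proof.
have mb (D : set 'I_n) (F : 'I_n -> set Om) :
    (forall i, measurable (F i)) -> measurable (\bigcap_(i in D) F i).
  by move=> mF; apply: fin_bigcap_measurable.
apply: measurableI; apply: mb => i; first exact: measurable_le_cst.
exact: measurable_gt_cst.
Qed.
End MeasurableEvents.

(** * Conditional means *)

Section Conditioning.
Variables (R : realType) (d : measure_display) (Om : measurableType d).
Variables (P : probability Om R) (D : set Om).
Hypotheses (mD : measurable D) (D_gt0 : 0 < prob P D).

Lemma probE (A : set Om) : measurable A -> (prob P A)%:E = P A.
Proof. by move=> mA; rewrite fineK // fin_num_measure. Qed.

Lemma prob_setT : prob P setT = 1.
Proof. by rewrite /prob probability_setT. Qed.

Lemma prob_setD (A B : set Om) : measurable A -> measurable B -> B `<=` A ->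
  prob P (A `\` B) = prob P A - prob P B.
Proof.
move=> mA mB BA; apply/EFin_inj; rewrite EFinB !probE //; last exact: measurableD.
rewrite measureD // ?setIidr //; last by rewrite ltey_eq fin_num_measure.
Qed.

(** The conditional mean given [D], cleared of its denominator. As a relation it carries
    integrability along with the value, so finite sums need no side conditions. *)
Definition cond_mean (f : Om -> R) (x : R) :=
  P.-integrable D (EFin \o f) /\ (\int[P]_(w in D) (f w)%:E)%E = (x * prob P D)%:E.

Lemma cond_mean_indic (E : set Om) :
  measurable E -> cond_mean (fun w => (w \in E)%:R) (cond_prob P E D).
Proof.
move=> mE; split.
  by apply: (@integrableS _ _ _ _ setT) => //; exact: integrable_indic.
rewrite integral_indic // /cond_prob divfK ?gt_eqF // probE //.
exact: measurableI.
Qed.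

Lemma cond_meanD f g x y :
  cond_mean f x -> cond_mean g y -> cond_mean (fun w => f w + g w) (x + y).
Proof.
move=> [If fx] [Ig gy]; split; first exact: (integrableD mD If Ig).
by under eq_integral do rewrite EFinD; rewrite integralD // fx gy -EFinD mulrDl.
Qed.

Lemma cond_mean0 : cond_mean (fun=> 0) 0.
Proof. by split; [exact: integrable0|rewrite integral0 mul0r]. Qed.

Lemma cond_mean_sum (I : Type) (r : seq I) (p : pred I) (f : I -> Om -> R) (x : I -> R) :
  (forall i, p i -> cond_mean (f i) (x i)) ->
  cond_mean (fun w => \sum_(i <- r | p i) f i w) (\sum_(i <- r | p i) x i).
Proof.
move=> fx; elim: r => [|i r IH].
  by rewrite big_nil; under eq_fun do rewrite big_nil; exact: cond_mean0.
rewrite big_cons; under eq_fun do rewrite big_cons.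
by case: ifP => // pi; apply: cond_meanD => //; exact: fx.
Qed.

(** Turns an identity of functions on [D] into an identity of conditional means, by cancelling the
    positive probability of [D]. *)
Lemma cond_mean_eq f g x y :
  cond_mean f x -> cond_mean g y -> (forall w, D w -> f w = g w) -> x = y.
Proof.
move=> [_ fx] [_ gy] fg; apply: (mulIf (lt0r_neq0 D_gt0)); apply/EFin_inj.
rewrite -fx -gy; apply: eq_integral => w; rewrite inE => /fg -> //.
Qed.
End Conditioning.

(** A pair of equations, so that a single rewriting rule recovers both the component lifetimes and
    the standby lifetime from the joint vector. *)
Lemma random_vector_add_last (R : realType) Om n (X : 'I_n -> Om -> R) (Z : Om -> R) w :
  ((fun i => tnth (random_vector (add_last X Z) w) (lift ord_max i)) = X^~ w) *
  (tnth (random_vector (add_last X Z) w) ord_max = Z w).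
Proof.
split; last by rewrite tnth_mktuple /add_last unlift_none.
by apply/funext => i; rewrite tnth_mktuple /add_last liftK.
Qed.

(** * Independent lifetimes *)

Section Product.
Variables (R : realType) (d : measure_display) (Om : measurableType d)
  (P : probability Om R) (n : nat) (X : 'I_n -> {RV P >-> R}) (Z : {RV P >-> R}).

(** Factorisation on rectangles, the common consequence of the independence assumptions in (i) and
    in (iii). *)
Definition product_law := forall (B : 'I_n -> set R) (C : set R),
  (forall i, measurable (B i)) -> measurable C ->
  prob P (\bigcap_i (X i @^-1` B i) `&` Z @^-1` C) =
  \prod_i prob P (X i @^-1` B i) * prob P (Z @^-1` C).

Lemma mutually_independent_product_law :
  mutually_independent P (add_last (fun i w => X i w) (fun w => Z w)) -> product_law.
Proof.
move=> ind B C mB mC.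
have mBC i : measurable (add_last B C i).
  by rewrite /add_last; case: unlift => [i'|]; [exact: mB|exact: mC].
have := ind [set: 'I_n.+1]%SET _ mBC.
rewrite (eq_bigl predT) => [|i]; last by rewrite inE.
rewrite (bigD1_ord ord_max) //= mulrC.
under eq_bigr do rewrite /add_last liftK.
rewrite /add_last unlift_none => <-; congr (prob P _).
apply/seteqP; split=> [w [h hC] i _|w h] /=.
  by case: unliftP => [i' _|_]; [exact: h|exact: hC].
split; last by have := h ord_max; rewrite /= unlift_none inE; apply.
by move=> i _; have := h (lift ord_max i); rewrite /= liftK inE; apply.
Qed.

(** A rectangle for the components is the preimage of one measurable set of tuples. Independence of
    the vector from [Z] splits off the last factor, and mutual independence splits the rest. *)
Lemma vector_independent_product_law :
  vector_independent P (fun i w => X i w) (fun w => Z w) ->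
  mutually_independent P (fun i w => X i w) -> product_law.
Proof.
move=> vind ind B C mB mC.
have := ind [set: 'I_n]%SET _ mB.
rewrite (eq_bigl predT) => [<-|i]; last by rewrite inE.
pose BB := \bigcap_i [set y : n.-tuple R | B i (tnth y i)].
have mBB : measurable BB.
  apply: fin_bigcap_measurable => // i _; rewrite -[X in measurable X]setTI.
  exact: (measurable_tnth (n := n) i).
have := vind BB C mBB mC.
have -> : random_vector (fun i w => X i w) @^-1` BB = \bigcap_i (X i @^-1` B i).
  by apply/seteqP; split=> w h i _; have := h i I; rewrite /= tnth_mktuple.
move=> ->; congr (prob P _ * _).
by apply/seteqP; split=> w h i _; apply: h => //=; rewrite inE.
Qed.

Hypothesis law : product_law.

(** The events prescribe sides by position, the law by component; the two are related by reindexing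
    along [j]. *)
Lemma prob_rect (j : 'S_n) (B : 'I_n -> set R) (C : set R) :
  (forall i, measurable (B i)) -> measurable C ->
  prob P (\bigcap_l (X (j l) @^-1` B l) `&` Z @^-1` C) =
  \prod_l prob P (X (j l) @^-1` B l) * prob P (Z @^-1` C).
Proof.
move=> mB mC; have := law (fun i => mB (j^-1 i)%g) mC.
rewrite (reindex_inj (@perm_inj _ j)) /=.
under eq_bigr do rewrite permK.
move=> <-; congr (prob P (_ `&` _)); apply/seteqP; split=> w h i _ /=.
  by have := h (j^-1 i)%g I; rewrite /= permKV.
by have := h (j i) I; rewrite /= permK.
Qed.

Definition alive (t : nat) := [set w | (t%:R%:E < order_stat (fun i => X i w) 1)%E].

Let F i x : R := fine (cdf (X i) x).
Let Fbar i x : R := fine (ccdf (X i) x).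
Let p i x : R := pmf (X i) x.
Let Fminus i x : R := prob P [set w | X i w < x].
Let Gbar x : R := fine (ccdf Z x).

Let mpre (Y : {RV P >-> R}) B : measurable B -> measurable (Y @^-1` B).
Proof. by move=> mB; exact: measurable_preim. Qed.

Lemma prob_oo i (a b : R) : a < b -> prob P (X i @^-1` `]a, b[) = Fminus i b - F i a.
Proof.
move=> ab; have -> : X i @^-1` `]a, b[ = [set w | X i w < b] `\` (X i @^-1` `]-oo, a]).
  apply/seteqP; split=> w /=; rewrite !in_itv /=.
    by move=> /andP[aw wb]; split=> //; apply/negP; rewrite -ltNge.
  by move=> [wb /negP]; rewrite -ltNge wb andbT.
rewrite prob_setD //; first exact: measurable_lt_cst.
  exact: mpre.
by move=> w /=; rewrite in_itv /= => /le_lt_trans; apply.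
Qed.

Lemma prob_oc i (a b : R) : a <= b -> prob P (X i @^-1` `]a, b]) = F i b - F i a.
Proof.
move=> ab; have -> : X i @^-1` `]a, b] = (X i @^-1` `]-oo, b]) `\` (X i @^-1` `]-oo, a]).
  apply/seteqP; split=> w /=; rewrite !in_itv /=.
    by move=> /andP[aw wb]; split=> //; apply/negP; rewrite -ltNge.
  by move=> [wb /negP]; rewrite -ltNge wb andbT.
rewrite prob_setD //; [exact: mpre|exact: mpre|].
by move=> w /=; rewrite !in_itv /= => /le_trans; apply.
Qed.

Lemma prob_alive t : prob P (alive t) = \prod_i Fbar i t%:R.
Proof.
transitivity (\prod_i prob P (X i @^-1` `]t%:R, +oo[) * prob P (Z @^-1` setT)).
  rewrite -law //; congr (prob P _); rewrite preimage_setT setIT.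
  apply/seteqP; split=> w /=.
    by move/order_stat1_gt => h i _ /=; rewrite in_itv /= h.
  by move=> h; apply/order_stat1_gt => i; have := h i I; rewrite /= in_itv /= andbT.
by rewrite preimage_setT prob_setT mulr1.
Qed.

(** In absolute time the event together with survival to [t] is a rectangle. Since [1 <= u], failure
    at [u + t] already implies survival to [t], and so does a lifetime above [s + t]; only the first
    block needs the lower bound [t]. *)
Lemma prob_evA k (t u s v : nat) (j : 'S_n) : (v <= n - k + 1)%N -> (1 <= u)%N ->
  prob P (evA k (fun i w => X i w - t%:R) Z u s v j `&` alive t) =
  (\prod_(l < n | (l < v)%N) (Fminus (j l) (u + t)%:R - F (j l) t%:R)) *
  (\prod_(l < n | (v <= l < n - k + 1)%N) p (j l) (u + t)%:R) *
  (\prod_(l < n | (n - k + 1 <= l)%N) Fbar (j l) (s + t)%:R) *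
  Gbar ((s + t)%:R - (u + t)%:R).
Proof.
move=> vm u1; set m := (n - k + 1)%N in vm *.
pose B (l : 'I_n) : set R := if (l < v)%N then `]t%:R, (u + t)%:R[%classic
  else if (l < m)%N then [set (u + t)%:R] else `](s + t)%:R, +oo[%classic.
have tu : t%:R < (u + t)%:R :> R by rewrite ltr_nat; lia.
have ts : t%:R <= (s + t)%:R :> R by rewrite ler_nat; lia.
have mB l : measurable (B l) by rewrite /B; case: ifP => _ //; case: ifP.
transitivity (prob P (\bigcap_l (X (j l) @^-1` B l) `&`
    Z @^-1` `](s + t)%:R - (u + t)%:R, +oo[)).
  congr (prob P _); apply/seteqP; split=> w.
    move=> [[[[h1 h2] h3] /= h4] /order_stat1_gt h5]; split; last first.
      by rewrite /= in_itv /= andbT; move: h4; rewrite !natrD; lra.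
    move=> l _; rewrite /= /B; case: ifP => lv.
      by rewrite /= in_itv /= h5 /=; have := h1 l lv; rewrite /= natrD; lra.
    case: ifP => lm.
      by have := h2 l; rewrite /= natrD leqNgt lv lm => /(_ isT); lra.
    by rewrite /= in_itv /=; have := h3 l; rewrite /= natrD leqNgt lm => /(_ isT); lra.
  move=> [h /=]; rewrite in_itv /= andbT => hZ.
  have hB l : B l (X (j l) w) by exact: h.
  split; last first.
    apply/order_stat1_gt => i; have := hB (j^-1 i)%g; rewrite /B permKV.
    case: ifP => lv /=; first by rewrite in_itv /= => /andP[].
    case: ifP => lm /=; first by move=> ->.
    by rewrite in_itv /= andbT; apply: le_lt_trans.
  split; last by move: hZ; rewrite /= !natrD; lra.
  split=> [|l /= ml]; last first.
    have := hB l; rewrite /B ltnNge (leq_trans vm ml) /= ltnNge ml /=.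
    by rewrite in_itv /= natrD; lra.
  split=> l /=.
    by move=> lv; have := hB l; rewrite /B lv /= in_itv /= natrD => /andP[_]; lra.
  move=> /andP[vl lm]; have := hB l; rewrite /B ltnNge vl lm /= natrD; lra.
rewrite prob_rect // (bigID (fun l : 'I_n => (l < m)%N)) /=; congr (_ * _).
rewrite (bigID (fun l : 'I_n => (l < v)%N)) /=; congr (_ * _ * _).
- apply: eq_big => [l|l /andP[_ lv]]; last by rewrite /B lv prob_oo.
  by case: (ltnP l v) => lv; rewrite ?andbF // (leq_trans lv vm).
- apply: eq_big => [l|l /andP[lm vl]]; first by rewrite -leqNgt andbC.
  by rewrite /B (negbTE vl) lm.
- apply: eq_big => [l|l lm]; first by rewrite -leqNgt.
  rewrite /B (negbTE lm) ltnNge (leq_trans vm) // leqNgt //.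
Qed.

Lemma prob_evC (t s v : nat) (j : 'S_n) :
  prob P (evC (fun i w => X i w - t%:R) s v j `&` alive t) =
  (\prod_(l < n | (l < v)%N) (F (j l) (s + t)%:R - F (j l) t%:R)) *
  (\prod_(l < n | (v <= l)%N) Fbar (j l) (s + t)%:R).
Proof.
(* The right end is closed because [evC] includes failures at time [s] itself; [Z] is left free,
   hence the factor [setT] below. *)
pose B (l : 'I_n) : set R := if (l < v)%N then `]t%:R, (s + t)%:R]%classic
  else `](s + t)%:R, +oo[%classic.
have ts : t%:R <= (s + t)%:R :> R by rewrite ler_nat; lia.
have mB l : measurable (B l) by rewrite /B; case: ifP.
transitivity (prob P (\bigcap_l (X (j l) @^-1` B l) `&` Z @^-1` setT)).
  rewrite preimage_setT setIT.
  congr (prob P _); apply/seteqP; split=> w.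
    move=> [[h1 h2] /order_stat1_gt h5].
    move=> l _; rewrite /= /B; case: ifP => lv.
      by rewrite /= in_itv /= h5 /=; have := h1 l lv; rewrite /= natrD; lra.
    by rewrite /= in_itv /=; have := h2 l; rewrite /= natrD leqNgt lv => /(_ isT); lra.
  move=> h; have hB l : B l (X (j l) w) by exact: h.
  split; last first.
    apply/order_stat1_gt => i; have := hB (j^-1 i)%g; rewrite /B permKV.
    case: ifP => lv /=; first by rewrite in_itv /= => /andP[].
    by rewrite in_itv /= andbT; apply: le_lt_trans.
  split=> l /= vl; have := hB l; rewrite /B.
    by rewrite vl /= in_itv /= natrD => /andP[_]; lra.
  by rewrite ltnNge vl /= in_itv /= natrD; lra.
rewrite prob_rect // preimage_setT prob_setT mulr1.
rewrite (bigID (fun l : 'I_n => (l < v)%N)) /=; congr (_ * _).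
  by apply: eq_bigr => l lv; rewrite /B lv prob_oc.
by apply: eq_big => [l|l lv]; [rewrite -leqNgt|rewrite /B (negbTE lv)].
Qed.
End Product.

(** * Multinomial counts and constant products for the symmetric cases *)

Lemma natr_card_perms2 (R : numFieldType) n v q : (v <= q)%N -> (q <= n)%N ->
  #|perms2 n v q|%:R = n`!%:R / (v`!%:R * (q - v)`!%:R * (n - q)`!%:R) :> R.
Proof.
move=> vq qn; have fn0 m : m`!%:R != 0 :> R by rewrite pnatr_eq0 -lt0n fact_gt0.
apply/(canRL (mulfK _)); first by rewrite ?mulf_neq0.
rewrite -!natrM card_perms2 //; congr _%:R.
(* The factorial of [n - v] cancels between the two binomial coefficients, leaving a multinomial
   coefficient. *)
have e : (n - v - (q - v) = n - q)%N by lia.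
have <- := bin_fact (leq_trans vq qn); have := bin_fact (leq_sub2r v qn).
by rewrite e => <-; rewrite !mulnA (mulnAC _ _ v`!).
Qed.

Lemma sum_const_perms2 (R : numFieldType) n v q (c : R) : (v <= q)%N -> (q <= n)%N ->
  \sum_(j in perms2 n v q) c =
  n`!%:R / (v`!%:R * (q - v)`!%:R * (n - q)`!%:R) * c.
Proof. by move=> vq qn; rewrite sumr_const -[LHS]mulr_natl natr_card_perms2. Qed.

Lemma prod_const_range (R : comNzRingType) n a b (c : R) : (a <= b)%N -> (b <= n)%N ->
  \prod_(l < n | (a <= l < b)%N) c = c ^+ (b - a).
Proof. by move=> ab bn; rewrite prodr_const card_ord_range. Qed.

(** * Pointwise decomposition of the survival indicator *)

Section Pointwise.
Variables (R : realType) (n k s : nat) (x : 'I_n -> R) (z : R).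
Hypotheses (k_ge1 : (1 <= k)%N) (k_le_n : (k <= n)%N).
Hypotheses (x_nat : forall i, x i \is a Num.nat) (x_gt0 : forall i, 0 < x i).
Hypothesis z_nat : z \is a Num.nat.
Variables (Om : Type) (X : 'I_n -> Om -> R) (Z : Om -> R) (w : Om).
Hypotheses (Xw : forall i, X i w = x i) (Zw : Z w = z).

Lemma indicator_decomposition :
  ((s%:R%:E < lifetime k x z)%E : nat)%:R =
  \sum_(0 <= v < (n - k).+1)
    (\sum_(j in perms2 n v (n - k + 1)) \sum_(1 <= u < s.+1)
       (w \in evA k X Z u s v j)%:R +
     \sum_(j in perms n v) (w \in evC X s v j)%:R) :> R.
Proof.
(* The values are naturals, so truncation loses nothing and the claim becomes [lifetime_fits] with
   [m = (n - k).+1]. *)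
pose y i := Num.truncn (x i); have yE i : x i = (y i)%:R by rewrite truncnK.
pose zn := Num.truncn z; have zE : z = zn%:R by rewrite truncnK.
have y_gt0 i : (0 < y i)%N by rewrite -(ltr_nat R) -yE.
have mn : ((n - k).+1 <= n)%N by lia.
have -> : (s%:R%:E < lifetime k x z)%E =
    (#|[pred i | y i + zn <= s]| < (n - k).+1)%N && (#|[pred i | y i <= s]| <= (n - k).+1)%N.
  rewrite lifetime_gt ltnS; congr (_ && _); congr (_ <= _)%N; apply: eq_card => i;
    by rewrite !inE yE ?zE -?natrD ler_nat.
rewrite (lifetime_fits s zn y_gt0) // natr_sum; apply: eq_bigr => v _.
rewrite natrD !natr_sum addn1; congr (_ + _); apply: eq_bigr => j _.
  rewrite natr_sum; apply: eq_bigr => u _; congr (nat_of_bool _)%:R.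
  apply/idP/idP => [/andP[/forallP h hz]|].
    rewrite inE; split; last by rewrite /= Zw zE ltrBlDr -natrD ltr_nat addnC.
    split; [split|] => l /= hl; rewrite Xw yE; have /and3P[h1 h2 h3] := h l.
    - by rewrite ltr_nat (implyP h1).
    - by rewrite addn1 in hl; rewrite (eqP (implyP h2 hl)).
    - by rewrite addn1 in hl; rewrite ltr_nat (implyP h3).
  rewrite inE => -[[[h1 h2] h3] h4]; apply/andP; split; last first.
    by move: h4; rewrite /= Zw zE ltrBlDr -natrD ltr_nat addnC.
  apply/forallP => l; apply/and3P; split; apply/implyP => hl.
  - by have := h1 l hl; rewrite /= Xw yE ltr_nat.
  - have := h2 l; rewrite addn1 => /(_ hl) /=; rewrite Xw yE => /eqP.
    by rewrite eqr_nat.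
  - by have := h3 l; rewrite addn1 => /(_ hl) /=; rewrite Xw yE ltr_nat.
congr (nat_of_bool _)%:R; apply/idP/idP => [/forallP h|].
  rewrite inE; split => l /= hl; rewrite Xw yE; have /and3P[h1 h2 h3] := h l.
    by rewrite ler_nat (implyP h1).
  by rewrite ltr_nat (implyP h2) // hl ltn_ord.
rewrite inE => -[h1 h2]; apply/forallP => l; apply/and3P; split; apply/implyP => hl.
- by have := h1 l hl; rewrite /= Xw yE ler_nat.
- by have := h2 l; case/andP: hl => hl _ /(_ hl) /=; rewrite Xw yE ltr_nat.
- by move: hl; rewrite leqNgt ltn_ord.
Qed.
End Pointwise.

(** * Reliability of the residual system and its special cases *)

Theorem theorem3p2 (R : realType)
    (d : measure_display) (Om : measurableType d) (P : probability Om R)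
    (n k : nat) (k_ge1 : (1 <= k)%N) (k_le_n : (k <= n)%N)
    (X : 'I_n -> {RV P >-> R}) (Z : {RV P >-> R})
    (X_nat : forall (i : 'I_n) (w : Om), X i w \is a Num.nat)
    (Z_nat : forall w : Om, Z w \is a Num.nat)
    (t : nat)
    (alive_gt0 : 0 < prob P [set w | (order_stat (fun i => X i w) 1 > t%:R%:E)%E])
    (d' : measure_display) (Om' : measurableType d') (P' : probability Om' R)
    (Xt : 'I_n -> {RV P' >-> R}) (Zt : {RV P' >-> R})
    (residual_law : forall B : set (n.+1.-tuple R), measurable B ->
       prob P' (random_vector
                  (add_last (fun i w => Xt i w) (fun w => Zt w)) @^-1` B) =
       cond_prob P
         (random_vector
            (add_last (fun i w => X i w - t%:R) (fun w => Z w)) @^-1` B)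
         [set w | (order_stat (fun i => X i w) 1 > t%:R%:E)%E])
    (s : nat) :
  let F i x : R := fine (cdf (X i) x) in
  let Fbar i x : R := fine (ccdf (X i) x) in
  let p i x : R := pmf (X i) x in
  let Fminus i x : R := prob P [set w | X i w < x] in
  let Gbar x : R := fine (ccdf Z x) in
  let T w := lifetime k (fun i => X i w) (Z w) in
  let Tt w := lifetime k (fun i => Xt i w) (Zt w) in
  let A u v j := evA k (fun i w => Xt i w) (fun w => Zt w) u s v j in
  let C v j := evC (fun i w => Xt i w) s v j in
  let reliability := prob P' [set w | (Tt w > s%:R%:E)%E] in
  [/\ cond_prob P [set w | (T w - t%:R%:E > s%:R%:E)%E]
        [set w | (order_stat (fun i => X i w) 1 > t%:R%:E)%E] = reliability,
      reliability =
        \sum_(0 <= v < (n - k).+1)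
          (\sum_(j in perms2 n v (n - k + 1)) \sum_(1 <= u < s.+1)
             prob P' (A u v j) +
           \sum_(j in perms n v) prob P' (C v j)),
      mutually_independent P (add_last (fun i w => X i w) (fun w => Z w)) ->
      reliability =
        (\prod_(l < n) Fbar l t%:R)^-1 *
        \sum_(0 <= v < (n - k).+1)
          (\sum_(j in perms2 n v (n - k + 1)) \sum_(t.+1 <= u < (s + t).+1)
             ((\prod_(l < n | (l < v)%N)
                 (Fminus (j l) u%:R - F (j l) t%:R)) *
              (\prod_(l < n | (v <= l < n - k + 1)%N) p (j l) u%:R) *
              (\prod_(l < n | (n - k + 1 <= l)%N) Fbar (j l) (s + t)%:R) *
              Gbar ((s + t)%:R - u%:R)) +
           \sum_(j in perms n v)
             ((\prod_(l < n | (l < v)%N)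
                 (F (j l) (s + t)%:R - F (j l) t%:R)) *
              (\prod_(l < n | (v <= l)%N) Fbar (j l) (s + t)%:R))),
      exchangeable P (add_last (fun i w => X i w) (fun w => Z w)) ->
      reliability =
        n`!%:R *
        \sum_(0 <= v < (n - k).+1) v`!%:R^-1 *
          (((n - k + 1 - v)`!%:R * (k - 1)`!%:R)^-1 *
             (\sum_(1 <= u < s.+1) prob P' (A u v 1%g)) +
           (n - v)`!%:R^-1 * prob P' (C v 1%g)) &
      vector_independent P (fun i w => X i w) (fun w => Z w) ->
      mutually_independent P (fun i w => X i w) ->
      identically_distributed P (fun i w => X i w) ->
      forall i : 'I_n,
      reliability =
        n`!%:R / Fbar i t%:R ^+ n *
        \sum_(0 <= v < (n - k).+1) v`!%:R^-1 *
          (Fbar i (t + s)%:R ^+ (k - 1) /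
             ((n - k + 1 - v)`!%:R * (k - 1)`!%:R) *
             (\sum_(t.+1 <= u < (s + t).+1)
                (Fminus i u%:R - F i t%:R) ^+ v *
                p i u%:R ^+ (n - k + 1 - v) *
                Gbar ((t + s)%:R - u%:R)) +
           (n - v)`!%:R^-1 *
             (F i (s + t)%:R - F i t%:R) ^+ v *
             Fbar i (s + t)%:R ^+ (n - v))].
Proof.
move=> F Fbar p Fminus Gbar T Tt A C reliability.
set D := [set w | (order_stat (fun i => X i w) 1 > t%:R%:E)%E] in alive_gt0 residual_law *.
pose Y i w := X i w - t%:R.
have mZ : measurable_fun setT Z by [].
have mY i : measurable_fun setT (Y i).
  by apply: measurable_realfun.measurable_funB => //; exact: measurable_cst.
have mD : measurable D by exact: measurable_alive.
(* An event expressed by the values of the residual vector is a preimage of a set of tuples, so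
   [residual_law] moves it to the original space. *)
have transfer (E : ('I_n -> R) -> R -> Prop) :
    measurable [set y : n.+1.-tuple R | E (fun i => tnth y (lift ord_max i)) (tnth y ord_max)] ->
    prob P' [set w | E (fun i => Xt i w) (Zt w)] =
    cond_prob P [set w | E (fun i => Y i w) (Z w)] D.
  move=> mE; have := residual_law _ mE; rewrite -/Y.
  by rewrite /preimage /=; under eq_set do rewrite !random_vector_add_last;
    under [in RHS]eq_set do rewrite !random_vector_add_last.
have mcoord (i : 'I_n.+1) : measurable_fun setT (fun y : n.+1.-tuple R => tnth y i).
  exact: measurable_tnth.
have probT : reliability = cond_prob P [set w | (lifetime k (Y^~ w) (Z w) > s%:R%:E)%E] D.
  apply: (transfer (fun x z => (lifetime k x z > s%:R%:E)%E)).
  exact: measurable_lifetime.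
(* Over the one-point sample space [unit], [evA] becomes a relation between the
   values, which can be pulled back along both random vectors. *)
have probA u v j : prob P' (A u v j) = cond_prob P (evA k Y Z u s v j) D.
  apply: (transfer (fun x z => evA k (fun i (_ : unit) => x i) (fun=> z) u s v j tt)).
  exact: (measurable_evA k (fun i => mcoord (lift ord_max i)) (mcoord ord_max)).
have probC v j : prob P' (C v j) = cond_prob P (evC Y s v j) D.
  apply: (transfer (fun x _ => evC (fun i (_ : unit) => x i) s v j tt)).
  exact: (measurable_evC (fun i => mcoord (lift ord_max i))).
(* The residual vector is known only in law, so the pointwise identity is used on the original
   space, where all values are naturals. Both sides are conditional means given [D] of functions
   that agree on [D]. *)
have decomposition : reliability =
    \sum_(0 <= v < (n - k).+1)
      (\sum_(j in perms2 n v (n - k + 1)) \sum_(1 <= u < s.+1) prob P' (A u v j) +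
       \sum_(j in perms n v) prob P' (C v j)).
  have mT := measurable_lifetime k mY mZ s%:R.
  apply: (cond_mean_eq alive_gt0 (f := fun w =>
      (w \in [set w | (lifetime k (Y^~ w) (Z w) > s%:R%:E)%E])%:R)
    (g := fun w => \sum_(0 <= v < (n - k).+1)
      (\sum_(j in perms2 n v (n - k + 1)) \sum_(1 <= u < s.+1)
         (w \in evA k Y Z u s v j)%:R +
       \sum_(j in perms n v) (w \in evC Y s v j)%:R))).
  - by rewrite probT; exact: cond_mean_indic.
  - apply: cond_mean_sum => // v _; apply: cond_meanD => //.
      apply: cond_mean_sum => // j _; apply: cond_mean_sum => // u _.
      by rewrite probA; apply: cond_mean_indic => //; exact: measurable_evA.
    apply: cond_mean_sum => // j _.
    by rewrite probC; apply: cond_mean_indic => //; exact: measurable_evC.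
  - move=> w /order_stat1_gt Dw.
    rewrite -(indicator_decomposition s k_ge1 k_le_n (x := Y^~ w) (z := Z w)) //.
    + by congr (nat_of_bool _)%:R; apply/idP/idP; rewrite inE.
    + move=> i; rewrite /Y; have /natrP[a Xa] := X_nat i w.
      by move: (Dw i); rewrite Xa ltr_nat => /ltnW ta; rewrite -natrB.
    + by move=> i; rewrite /Y subr_gt0.
(* Shared by (i) and (iii), whose assumptions both yield [product_law]. *)
have formula : product_law X Z -> reliability =
    (\prod_(l < n) Fbar l t%:R)^-1 *
    \sum_(0 <= v < (n - k).+1)
      (\sum_(j in perms2 n v (n - k + 1)) \sum_(t.+1 <= u < (s + t).+1)
         ((\prod_(l < n | (l < v)%N) (Fminus (j l) u%:R - F (j l) t%:R)) *
          (\prod_(l < n | (v <= l < n - k + 1)%N) p (j l) u%:R) *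
          (\prod_(l < n | (n - k + 1 <= l)%N) Fbar (j l) (s + t)%:R) *
          Gbar ((s + t)%:R - u%:R)) +
       \sum_(j in perms n v)
         ((\prod_(l < n | (l < v)%N) (F (j l) (s + t)%:R - F (j l) t%:R)) *
          (\prod_(l < n | (v <= l)%N) Fbar (j l) (s + t)%:R))).
  move=> law; rewrite decomposition mulr_sumr; apply: eq_big_nat => v /andP[_ vm].
  rewrite mulrDr !mulr_sumr; congr (_ + _); apply: eq_bigr => j _.
    (* Shifts the summation index from residual time [u] to absolute time [u + t]. *)
    rewrite mulr_sumr -[t.+1]add1n -[(s + t).+1]addSn big_addn addnK.
    apply: eq_big_nat => u /andP[u1 _].
    rewrite probA /cond_prob mulrC -(prob_alive law); congr (_ * _).
    by rewrite (prob_evA law) // addn1 ltnW.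
  by rewrite probC /cond_prob mulrC -(prob_alive law) (prob_evC law).
split.
- rewrite probT /cond_prob; congr (prob P (_ `&` _) / _).
  by apply/funext => w; rewrite /mkset lifetimeB_gt.
- exact: decomposition.
- by move=> ind; apply: formula; exact: mutually_independent_product_law.
- move=> exch.
  (* Exchangeability is applied to the extension of [j] that fixes the last coordinate, so the
     standby lifetime stays in place. *)
  have swap (E E' : ('I_n -> R) -> R -> Prop) (j : 'S_n) :
      measurable [set y : n.+1.-tuple R | E (fun i => tnth y (lift ord_max i)) (tnth y ord_max)] ->
      (forall x z, E' x z <-> E (fun i => x (j i)) z) ->
      prob P [set w | E' (fun i => X i w) (Z w)] = prob P [set w | E (fun i => X i w) (Z w)].
    set B := [set y | _] => mB EE'; have := exch (lift_perm ord_max ord_max j) _ mB.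
    have -> : random_vector (add_last (fun i w => X i w) (fun w => Z w)) @^-1` B =
        [set w | E (fun i => X i w) (Z w)].
      by apply/funext => w; rewrite /preimage /B /= !random_vector_add_last.
    move=> <-; congr (prob P _); rewrite /preimage /B /=; apply/funext => w /=.
    rewrite tnth_mktuple lift_perm_id /add_last unlift_none.
    have -> : (fun i => tnth (random_vector (fun i => (add_last (fun i w => X i w)
        (fun w => Z w)) (lift_perm ord_max ord_max j i)) w) (lift ord_max i)) =
        fun i => X (j i) w.
      by apply/funext => i; rewrite tnth_mktuple lift_perm_lift /add_last liftK.
    exact/propext/EE'.
  have malive : measurable [set y : n.+1.-tuple R |
      (t%:R%:E < order_stat (fun i => tnth y (lift ord_max i)) 1)%E].
    by apply: measurable_alive => i.
  have mcoordt i : measurable_fun setT (fun y : n.+1.-tuple R => tnth y (lift ord_max i) - t%:R).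
    by apply: measurable_realfun.measurable_funB => //; exact: measurable_cst.
  have alive_perm (x : 'I_n -> R) (j : 'S_n) :
      (t%:R%:E < order_stat x 1)%E <-> (t%:R%:E < order_stat (fun i => x (j i)) 1)%E.
    rewrite !order_stat1_gt; split=> h i //.
    by rewrite -(permKV j i).
  (* The event for [j] is the event for the identity with the lifetimes permuted by [j], and
     survival of all components to [t] is symmetric. *)
  have probA1 u v j : prob P' (A u v j) = prob P' (A u v 1%g).
    rewrite !probA /cond_prob; congr (_ / _).
    apply: (swap (fun x z => evA k (fun i (_ : unit) => x i - t%:R) (fun=> z) u s v 1%g tt /\
         (t%:R%:E < order_stat x 1)%E)
      (fun x z => evA k (fun i (_ : unit) => x i - t%:R) (fun=> z) u s v j tt /\
         (t%:R%:E < order_stat x 1)%E) j) => [|x z].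
      apply: measurableI => //.
      exact: (measurable_evA k mcoordt (mcoord ord_max)).
    rewrite -alive_perm; split=> -[[[[h1 h2] h3] h4] h5]; do ![split] => // l /=.
    + by rewrite perm1; exact: h1.
    + by rewrite perm1; exact: h2.
    + by rewrite perm1; exact: h3.
    + by move/h1; rewrite /= perm1.
    + by move/h2; rewrite /= perm1.
    + by move/h3; rewrite /= perm1.
  have probC1 v j : prob P' (C v j) = prob P' (C v 1%g).
    rewrite !probC /cond_prob; congr (_ / _).
    apply: (swap (fun x _ => evC (fun i (_ : unit) => x i - t%:R) s v 1%g tt /\
         (t%:R%:E < order_stat x 1)%E)
      (fun x _ => evC (fun i (_ : unit) => x i - t%:R) s v j tt /\
         (t%:R%:E < order_stat x 1)%E) j) => [|x z].
      apply: measurableI => //.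
      exact: (measurable_evC mcoordt).
    rewrite -alive_perm; split=> -[[h1 h2] h3]; do ![split] => // l /=.
    + by rewrite perm1; exact: h1.
    + by rewrite perm1; exact: h2.
    + by move/h1; rewrite /= perm1.
    + by move/h2; rewrite /= perm1.
  rewrite decomposition mulr_sumr; apply: eq_big_nat => v /andP[_ vm].
  have vm' : (v <= n - k + 1)%N by lia.
  under eq_bigr do under eq_bigr do rewrite probA1.
  under [X in _ + X]eq_bigr do rewrite probC1.
  rewrite perms_perms2 !sum_const_perms2 //; try lia.
  have -> : (n - (n - k + 1) = k - 1)%N by lia.
  rewrite subnn fact0 mulr1 !invfM; ring.
- move=> vind ind ident i.
  have law := vector_independent_product_law vind ind.
  have FE i' x : F i' x = F i x by apply: ident.
  have FbarE i' x : Fbar i' x = Fbar i x by apply: ident.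
  have pE i' x : p i' x = p i x by apply: ident.
  (* The preceding three functions unfold to probabilities of preimages; [Fminus] is first rewritten
     as one. *)
  have FmE i' x : Fminus i' x = Fminus i x.
    have E i0 : [set w | X i0 w < x] = X i0 @^-1` `]-oo, x[.
      by apply/seteqP; split=> w /=; rewrite in_itv.
    by rewrite /Fminus !E; exact: ident.
  rewrite (formula law).
  under eq_bigr do rewrite FbarE.
  rewrite prodr_const card_ord !mulr_sumr; apply: eq_big_nat => v /andP[_ vm].
  have vm' : (v <= n - k + 1)%N by lia.
  have mn : (n - k + 1 <= n)%N by lia.
  have constE a b (g : 'I_n -> R) c : (a <= b)%N -> (b <= n)%N -> (forall l, g l = c) ->
      \prod_(l < n | (a <= l < b)%N) g l = c ^+ (b - a).
    by move=> ab bn gc; under eq_bigr do rewrite gc; exact: prod_const_range.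
  (* One-sided ranges of positions are given both ends so that [constE] turns their products into
     powers. *)
  have lt_range b (l : 'I_n) : (l < b)%N = (0 <= l < b)%N by [].
  have ge_range a (l : 'I_n) : (a <= l)%N = (a <= l < n)%N by rewrite ltn_ord andbT.
  under [X in X + _]eq_bigr => j _.
    under eq_bigr => u _.
      rewrite (eq_bigl _ _ (lt_range v)) (constE 0 v _ (Fminus i u%:R - F i t%:R)); last 3 first.
      + by [].
      + exact: leq_trans mn.
      + by move=> l; rewrite FmE FE.
      rewrite (constE v _ _ (p i u%:R)) //.
      rewrite (eq_bigl _ _ (ge_range (n - k + 1)%N)) (constE _ n _ (Fbar i (s + t)%:R)) //.
      over.
    over.
  under [X in _ + X]eq_bigr => j _.
    rewrite (eq_bigl _ _ (lt_range v)) (constE 0 v _ (F i (s + t)%:R - F i t%:R)); last 3 first.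
    + by [].
    + exact: leq_trans mn.
    + by move=> l; rewrite !FE.
    rewrite (eq_bigl _ _ (ge_range v)) (constE _ n _ (Fbar i (s + t)%:R)) //; last first.
      exact: leq_trans mn.
    over.
  rewrite perms_perms2 !sum_const_perms2 //; try lia.
  have -> : (n - (n - k + 1) = k - 1)%N by lia.
  rewrite subnn fact0 mulr1 !invfM subn0 (addnC t s).
  (* The power of [Fbar] does not depend on [u] and is moved in front of the sum. *)
  rewrite (eq_bigr (fun u => Fbar i (s + t)%:R ^+ (k - 1) *
    ((Fminus i u%:R - F i t%:R) ^+ v * p i u%:R ^+ (n - k + 1 - v) *
     Gbar ((s + t)%:R - u%:R)))) => [|u _]; last by rewrite mulrAC mulrC.
  rewrite -mulr_sumr; ring.
Qed.
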